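(* Let $n\ge2$, $0<p<1$, $0\le\theta<1$, let $X_1,\dots,X_n$ be i.i.d. Bernoulli random variables with $\mathbb P(X_i=1)=p$, and let $G$ be the random graph on $\{1,\dots,n\}$ in which distinct vertices $i,j$ are adjacent iff $X_i+X_j>\theta$. Then the mean spectral distribution $\mu_n=\mathbb E[\mu_n(G)]$ is \[ \mu_n=\Big(p-\frac1n\Big)\delta_{-1}+\Big(1-p-\frac1n\Big)\delta_0+\frac1n\sum_{k=0}^n\binom nk p^k(1-p)^{n-k}\big(\delta_{\lambda_-(k)}+\delta_{\lambda_+(k)}\big), \] where $\lambda_\pm(k)=\dfrac{k-1\pm\sqrt{(k-1)^2+4k(n-k)}}{2}$ for $k=0,1,\dots,n$.
   Context: For a graph $G$ on $n$ vertices, $\mu_n(G)=\frac1n\sum_{i=1}^n\delta_{\mu_i}$ where $\mu_1,\dots,\mu_n$ are the eigenvalues with multiplicity of its adjacency matrix; the mean spectral distribution is the expectation of this random measure, i.e. the measure $B\mapsto\mathbb E[\mu_n(G)(B)]$. *)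

(* Defs.v *)
From HB Require Import structures.
From mathcomp Require Import all_boot all_order all_algebra.
From mathcomp Require Import all_classical all_reals all_analysis.
From mathcomp Require Import polyrcf.

Set Implicit Arguments.
Unset Strict Implicit.
Unset Printing Implicit Defensive.

Import Order.TTheory GRing.Theory Num.Theory.
Import numFieldNormedType.Exports.

Local Open Scope classical_set_scope.
Local Open Scope ring_scope.

Record sgraph (n : nat) := SGraph {
  adj :> rel 'I_n;
  adj_sym : symmetric adj;
  adj_irr : irreflexive adj
}.

Definition adjacency_mx (R : realType) (n : nat) (G : sgraph n) : 'M[R]_n :=
  \matrix_(i, j) (G i j)%:R.

(* The real roots of the characteristic polynomial, each repeated according to
   its multiplicity. When A is symmetric this lists all n eigenvalues. *)
Definition spectrum (R : realType) (n : nat) (A : 'M[R]_n) : seq R :=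
  flatten [seq nseq (mup x (char_poly A)) x | x <- rootsR (char_poly A)].

Lemma count_mem_spectrum (R : realType) (n : nat) (A : 'M[R]_n) (x : R) :
  count_mem x (spectrum A) = mup x (char_poly A).
Proof.
rewrite /spectrum; pose q : {poly R} := char_poly A; rewrite -/q.
have q0 : q != 0 by rewrite monic_neq0 ?char_poly_monic.
have qE y : (y \in rootsR q) = root q y.
  by rewrite -(roots_on_rootsR q0) in_itv.
rewrite count_flatten -map_comp.
have := uniq_roots (- cauchy_bound q) (cauchy_bound q) q.
rewrite -/(rootsR q) => uq.
rewrite sumnE big_map (eq_bigr (fun y => (y == x) * mup y q)%N); last first.
  by move=> y _ /=; rewrite count_nseq.
case: (boolP (x \in rootsR q)) => [xq|xNq].
  rewrite (bigD1_seq x)//= eqxx mul1n big1 ?addn0// => y /negPf ->.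
  by rewrite mul0n.
rewrite big_seq big1 ?mupNroot -?qE// => y yq.
by rewrite (_ : y == x = false)//; apply: contraNF xNq => /eqP <-.
Qed.

Lemma mem_spectrum (R : realType) (n : nat) (A : 'M[R]_n) (x : R) :
  (x \in spectrum A) = eigenvalue A x.
Proof.
rewrite -has_pred1 has_count count_mem_spectrum eigenvalue_root_char.
rewrite -XsubC_dvd ?dvdp_XsubCl//.
by rewrite monic_neq0 ?char_poly_monic.
Qed.

Definition spectral_distribution (R : realType) (n : nat) (G : sgraph n) :
    {measure set R -> \bar R} :=
  let s := spectrum (adjacency_mx R G) in
  mscale (n%:R^-1)%:nng (msum (fun i => \d_(s`_i)) (size s)).

Definition mean_spectral_distribution (d : measure_display)
    (T : measurableType d) (R : realType) (P : probability T R) (n : nat)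
    (G : T -> sgraph n) (B : set R) : \bar R :=
  (\int[P]_w spectral_distribution R (G w) B)%E.

Section threshold_graph.
Variables (R : realType) (n : nat) (theta : R) (x : 'I_n -> R).

Definition threshold_rel : rel 'I_n :=
  fun i j => (i != j) && (theta < x i + x j).

Lemma threshold_rel_sym : symmetric threshold_rel.
Proof. by move=> i j; rewrite /threshold_rel eq_sym addrC. Qed.

Lemma threshold_rel_irr : irreflexive threshold_rel.
Proof. by move=> i; rewrite /threshold_rel eqxx. Qed.

Definition threshold_graph : sgraph n :=
  SGraph threshold_rel_sym threshold_rel_irr.

End threshold_graph.

Definition mutually_independent (d : measure_display) (T : measurableType d)
    (R : realType) (P : probability T R) (I : finType)
    (X : I -> {RV P >-> R}) : Prop :=
  forall (J : {set I}) (B : I -> set R),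
    (forall i, i \in J -> measurable (B i)) ->
    P (\bigcap_(i in [set` J]) (X i @^-1` B i)) =
    (\prod_(i in J) P (X i @^-1` B i))%E.

(* bernoulli_prob lives on bool; its image on R gives mass p to 1 and 1 - p
   to 0. *)
Definition has_bernoulli_law (d : measure_display) (T : measurableType d)
    (R : realType) (P : probability T R) (p : R) (X : {RV P >-> R}) : Prop :=
  forall B : set R, measurable B ->
    distribution P X B =
    pushforward (bernoulli_prob p) (fun b : bool => b%:R : R) B.

Definition lambda_minus (R : realType) (n k : nat) : R :=
  (k%:R - 1 - Num.sqrt ((k%:R - 1) ^+ 2 + 4 * k%:R * (n%:R - k%:R))) / 2.

Definition lambda_plus (R : realType) (n k : nat) : R :=
  (k%:R - 1 + Num.sqrt ((k%:R - 1) ^+ 2 + 4 * k%:R * (n%:R - k%:R))) / 2.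

(* Main.v *)
(* With k ones the graph is a clique on k vertices joined to n - k independent
   ones, so x - A is a diagonal matrix perturbed by a matrix of rank two, and the
   determinant reduces to a 2 x 2 one:
     char_poly A * X (X + 1) = (X + 1)^k X^(n-k) (X - lambda_-(k)) (X - lambda_+(k)).
   Hence the spectrum is -1 with multiplicity k - 1, 0 with multiplicity n - k - 1,
   and lambda_-(k), lambda_+(k), where a multiplicity -1 cancels against one of the
   lambda's. It remains to average over the binomial variable k, of mean n p. *)
Require Import Defs.
From HB Require Import structures.
From mathcomp Require Import all_boot all_order all_algebra.
From mathcomp Require Import all_classical all_reals all_analysis.
From mathcomp Require Import measurable_realfun ring.

Set Implicit Arguments.
Unset Strict Implicit.
Unset Printing Implicit Defensive.

Import Order.TTheory GRing.Theory Num.Theory.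
Import numFieldNormedType.Exports.

Local Open Scope classical_set_scope.
Local Open Scope ring_scope.

(** * Characteristic polynomial of a clique joined to an independent set *)

(* Weinstein-Aronszajn: eliminate either diagonal block of [[D, U], [-V, 1]]. *)
Lemma det_add_mulmx (R : comNzRingType) (n m : nat) (D D' : 'M[R]_n)
    (U : 'M[R]_(n, m)) (V : 'M[R]_(m, n)) : D *m D' = 1%:M ->
  \det (D + U *m V) = \det D * \det (1%:M + V *m D' *m U).
Proof.
move=> DD'.
pose W : 'M[R]_m := 1%:M + V *m D' *m U.
have : block_mx 1%:M U 0 1%:M *m block_mx (D + U *m V) 0 (- V) 1%:M
    = block_mx D 0 (- V) W *m block_mx 1%:M (D' *m U) 0 1%:M.
  rewrite !mulmx_block !mul1mx !mul0mx !mulmx1 !mulmx0.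
  rewrite mulmxN mulNmx !add0r !addr0 addrK mulmxA DD' mul1mx.
  by rewrite /W mulmxA addrCA addNr addr0.
move/(congr1 determinant).
rewrite (det_mulmx (block_mx 1%:M U 0 1%:M)).
rewrite (det_mulmx (block_mx D 0 (- V) W)) !det_ublock !det_lblock.
by rewrite !det1 !mul1r !mulr1.
Qed.

Lemma det_mx22 (R : comNzRingType) (A : 'M[R]_2) :
  \det A = A 0 0 * A 1 1 - A 0 1 * A 1 0.
Proof.
have e1 : lift (0 : 'I_2) (0 : 'I_1) = 1 by apply: val_inj.
have e2 : lift (1 : 'I_2) (0 : 'I_1) = 0 by apply: val_inj.
rewrite (expand_det_row _ 0) big_ord_recl big_ord1 e1 /cofactor !det_mx11.
rewrite [X in _ * (_ * X)]mxE.
rewrite [X in _ + _ * (_ * X)]mxE.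
rewrite [X in _ * (_ * X)]mxE.
rewrite [X in _ + _ * (_ * X)]mxE.
by rewrite e1 e2 addn0 add0n expr0 expr1 mul1r mulN1r mulrN.
Qed.

(* The adjacency matrix of a clique on S joined to an independent set. *)
Definition split_mx (R : nzRingType) (n : nat) (S : {set 'I_n}) : 'M[R]_n :=
  \matrix_(i, j) ((i != j) && ((i \in S) || (j \in S)))%:R.

Lemma card_ord_set_le (n : nat) (S : {set 'I_n}) : (#|S| <= n)%N.
Proof. by rewrite -[leqRHS]card_ord max_card. Qed.

Lemma card_notin (n : nat) (S : {set 'I_n}) :
  #|[pred i | i \notin S]| = (n - #|S|)%N.
Proof.
by apply/(@addnI #|S|); rewrite subnKC ?card_ord_set_le// cardC card_ord.
Qed.

(* x - split_mx S is diagonal plus t t^T - 1 1^T, with t the indicator of the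
   complement of S. *)
Lemma det_split_mx (R : fieldType) (n : nat) (S : {set 'I_n}) (x : R) :
  x != 0 -> x + 1 != 0 ->
  \det (x%:M - split_mx R S) * (x * (x + 1)) =
  (x + 1) ^+ #|S| * x ^+ (n - #|S|) *
  (x * (x + 1) - #|S|%:R * x - #|S|%:R * (n - #|S|)%:R).
Proof.
move=> x0 x10; pose c i := if i \in S then x + 1 else x.
have c0 i : c i != 0 by rewrite /c; case: ifP.
(* The columns of [U] are 1 and t, the rows of [V] are -1^T and t^T, so [U *m V] is t t^T - 1 1^T.
   On the diagonal this is -1 on S and 0 off S, which is why [c] is [x + 1] on S and [x] off it. *)
pose U : 'M[R]_(n, 2) := \matrix_(i, j) (if j == 0 then 1 else (i \notin S)%:R).
pose V : 'M[R]_(2, n) := \matrix_(j, i) (if j == 0 then -1 else (i \notin S)%:R).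
pose D := diag_mx (\row_i c i); pose D' := diag_mx (\row_i (c i)^-1).
have DD' : D *m D' = 1%:M.
  rewrite mulmx_diag -diag_const_mx; congr diag_mx.
  by apply/rowP => i; rewrite !mxE divff.
have -> : x%:M - split_mx R S = D + U *m V.
  apply/matrixP => i j; rewrite !mxE big_ord_recl big_ord1 !mxE/= /c.
  case: eqVneq => [<-|ij] /=; case: (boolP (i \in S)) => iS //=;
    rewrite ?mulr1n ?mulr0n; try (by ring);
    by case: (boolP (j \in S)) => jS /=; ring.
rewrite (det_add_mulmx _ _ DD').
have sumc (F : bool -> R) :
    \sum_i F (i \in S) = #|S|%:R * F true + (n - #|S|)%:R * F false.
  rewrite (bigID (mem S))/= (eq_bigr (fun=> F true)); last by move=> i ->.
  rewrite [X in _ + X](eq_bigr (fun=> F false)); last by move=> i /negPf ->.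
  by rewrite !sumr_const card_notin !mulr_natl.
have detD : \det D = (x + 1) ^+ #|S| * x ^+ (n - #|S|).
  rewrite det_diag (eq_bigr c) => [|i _]; last by rewrite mxE.
  rewrite (bigID (mem S))/= (eq_bigr (fun=> x + 1)); last by move=> i; rewrite /c => ->.
  rewrite [X in _ * X](eq_bigr (fun=> x)); last by move=> i; rewrite /c => /negPf ->.
  by rewrite !prodr_const card_notin.
pose k : R := #|S|%:R; pose l : R := (n - #|S|)%:R.
pose f (b : bool) : R := if b then x + 1 else x.
(* [g i j b] is what a vertex contributes to entry (i, j) of [V *m D' *m U]; it depends on the
   vertex only through its membership [b] in S. *)
pose g (i j : 'I_2) (b : bool) : R :=
  (if i == 0 then -1 else (~~ b)%:R) * (f b)^-1 * (if j == 0 then 1 else (~~ b)%:R).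
have : forall i j, (1%:M + V *m D' *m U) i j =
    (i == j)%:R + (k * g i j true + l * g i j false).
  move=> i j; rewrite -sumc mul_mx_diag !mxE; congr (_ + _).
  by apply: eq_bigr => m _; rewrite !mxE.
rewrite detD; move: (1%:M + _) => M E.
rewrite det_mx22 4!E /g /f /=.
by field; rewrite x0.
Qed.

Lemma horner_char_poly (R : comNzRingType) (n : nat) (A : 'M[R]_n) (x : R) :
  (char_poly A).[x] = \det (x%:M - A).
Proof.
rewrite -/(horner_eval x _) -det_map_mx; congr determinant.
apply/matrixP => i j.
by rewrite /char_poly_mx !mxE /= /horner_eval !hornerE hornerMn hornerX.
Qed.

(** The difference vanishes at [size (p - q)] distinct positive integers, one more than its degree
    allows. Testing at positive points only avoids 0 and -1, where [det_split_mx] does not apply. *)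
Lemma poly_eq_pos (R : numDomainType) (p q : {poly R}) :
  (forall x, 0 < x -> p.[x] = q.[x]) -> p = q.
Proof.
move=> pq; apply/eqP; rewrite -subr_eq0; apply/eqP.
apply: (@roots_geq_poly_eq0 _ _ [seq i.+1%:R | i <- iota 0 (size (p - q)%R)]).
- by apply/allP => _ /mapP[i _ ->]; rewrite rootE !hornerE pq ?subrr ?ltr0n.
- by rewrite map_inj_uniq ?iota_uniq// => i j /eqP; rewrite eqr_nat => /eqP[].
- by rewrite size_map size_iota.
Qed.

(** The factor X (X + 1) stays on the left so that all exponents are natural numbers even when S is
    empty or full. Only the sum and product of [a] and [b] matter, which keeps square roots out of
    the computation. *)
Lemma char_poly_split_mx (R : numFieldType) (n : nat) (S : {set 'I_n}) (a b : R) :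
  a + b = #|S|%:R - 1 -> a * b = - (#|S|%:R * (n - #|S|)%:R) ->
  char_poly (split_mx R S) * \prod_(z <- [:: -1; 0]) ('X - z%:P) =
  \prod_(z <- nseq #|S| (-1) ++ nseq (n - #|S|) 0 ++ [:: a; b]) ('X - z%:P).
Proof.
move=> ab_add ab_mul; apply: poly_eq_pos => x x0.
have x10 : x + 1 != 0 by rewrite gt_eqF// addr_gt0.
rewrite !big_cat/= !big_nseq !big_cons !big_nil !iter_mulr_1.
rewrite !hornerM !horner_exp !hornerXsubC horner_char_poly -polyC1 hornerC.
rewrite !opprK !subr0 !mulr1 [(x + 1) * x]mulrC det_split_mx ?(gt_eqF x0)// -mulrA.
congr (_ * (_ * _)); rewrite [RHS](_ : _ = x ^+ 2 - (a + b) * x + a * b); last by ring.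
by rewrite ab_add ab_mul; ring.
Qed.

(** * The spectrum in terms of the lambdas *)

Lemma lambdaD (R : realType) (n k : nat) :
  lambda_minus R n k + lambda_plus R n k = k%:R - 1.
Proof. by rewrite /lambda_minus /lambda_plus; field. Qed.

Lemma lambdaM (R : realType) (n k : nat) : (k <= n)%N ->
  lambda_minus R n k * lambda_plus R n k = - (k%:R * (n - k)%:R).
Proof.
move=> kn; rewrite /lambda_minus /lambda_plus natrB//.
(* [k <= n] makes the discriminant nonnegative, so squaring undoes [Num.sqrt]. *)
set d := (X in Num.sqrt X); have d0 : 0 <= d.
  by rewrite addr_ge0 ?sqr_ge0// mulr_ge0 ?mulr_ge0// subr_ge0 ler_nat.
rewrite (_ : _ * _ = ((k%:R - 1) ^+ 2 - Num.sqrt d ^+ 2) / 4); last by field.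
by rewrite sqr_sqrtr// /d; field.
Qed.

(** Occurrences in either list are root multiplicities of the two sides of [char_poly_split_mx], and
    multiplicities add over products. *)
Lemma perm_eq_spectrum_split_mx (R : realType) (n : nat) (S : {set 'I_n}) :
  perm_eq ([:: -1; 0] ++ spectrum (split_mx R S))
    (nseq #|S| (-1) ++ nseq (n - #|S|) 0 ++
      [:: lambda_minus R n #|S|; lambda_plus R n #|S|]).
Proof.
have Sn := card_ord_set_le S.
apply/allP => z _; apply/eqP; rewrite -[RHS]mu_prod_XsubC.
rewrite -(char_poly_split_mx (lambdaD R n #|S|) (lambdaM R Sn)).
rewrite mupM ?monic_neq0 ?char_poly_monic ?monic_prod_XsubC//.
by rewrite mu_prod_XsubC count_cat count_mem_spectrum addnC.
Qed.

(** The weights live in [R], where they may equal -1: for empty S the term at -1 cancels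
    [lambda_minus] = -1, and for full S the term at 0 cancels a lambda equal to 0. *)
Lemma sum_spectrum_split_mx (R : realType) (n : nat) (S : {set 'I_n}) (F : R -> R) :
  \sum_(z <- spectrum (split_mx R S)) F z =
  (#|S|%:R - 1) * F (-1) + (n%:R - #|S|%:R - 1) * F 0 +
  (F (lambda_minus R n #|S|) + F (lambda_plus R n #|S|)).
Proof.
have Sn := card_ord_set_le S.
have := perm_big _ (perm_eq_spectrum_split_mx R S) (P := xpredT) (F := F)
  (op := +%R) (x := 0).
rewrite !big_cat /= !big_cons !big_nil !big_nseq !iter_addr !addr0.
rewrite -[F 0 *+ _]mulr_natl -[F (-1) *+ _]mulr_natl natrB//.
set s := \sum_(_ <- _) _ => e.
by apply: (@addrI _ (F (-1) + F 0)); rewrite e; ring.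
Qed.

Lemma spectral_distributionE (R : realType) (n : nat) (G : sgraph n) (B : set R) :
  spectral_distribution R G B =
  (n%:R^-1 * \sum_(z <- spectrum (adjacency_mx R G)) (z \in B)%:R)%:E.
Proof.
rewrite /spectral_distribution /= /mscale /= /msum EFinM (big_nth 0) big_mkord.
by rewrite -sumEFin; congr (_ * _)%E; apply: eq_bigr => i _; rewrite /= diracE.
Qed.

(** A sum of two 0/1 values is 0 or at least 1, and [theta] separates these cases. *)
Lemma adjacency_threshold_graph (R : realType) (n : nat) (theta : R) (x : 'I_n -> R) :
  0 <= theta < 1 -> (forall i, x i = 0 \/ x i = 1) ->
  adjacency_mx R (threshold_graph theta x) = split_mx R [set i | x i == 1]%SET.
Proof.
move=> /andP[t0 t1] x01; apply/matrixP => i j; rewrite !mxE !inE /=.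
rewrite /threshold_rel; congr (_ && _)%:R.
have [-> | ->] := x01 i; have [-> | ->] := x01 j;
  rewrite ?eqxx ?(@eq_sym _ 0 1) ?oner_eq0 ?addr0 ?add0r//=.
- by apply/negbTE; rewrite -leNgt.
- by rewrite (lt_le_trans t1)// lerDl.
Qed.

(** * Binomial sums *)

Lemma sum_binomial (R : comPzRingType) (n : nat) (p : R) :
  \sum_(k < n.+1) 'C(n, k)%:R * p ^+ k * (1 - p) ^+ (n - k) = 1.
Proof.
transitivity ((1 - p + p) ^+ n); last by rewrite subrK expr1n.
by rewrite exprDn; apply: eq_bigr => k _; rewrite -[RHS]mulr_natl; ring.
Qed.

(** Absorption, (k+1) C(n+1, k+1) = (n+1) C(n, k), after dropping the zero term k = 0. *)
Lemma mean_binomial (R : comPzRingType) (n : nat) (p : R) :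
  \sum_(k < n.+1) k%:R * ('C(n, k)%:R * p ^+ k * (1 - p) ^+ (n - k)) = n%:R * p.
Proof.
case: n => [|n]; first by rewrite big_ord1 !mul0r.
rewrite big_ord_recl mul0r add0r.
transitivity (n.+1%:R * p * \sum_(k < n.+1) 'C(n, k)%:R * p ^+ k * (1 - p) ^+ (n - k));
  last by rewrite sum_binomial mulr1.
rewrite mulr_sumr.
apply: eq_bigr => k _; rewrite lift0 subSS exprS !mulrA -natrM -mul_bin_diag natrM.
ring.
Qed.

Lemma sum_card_set (R : pzSemiRingType) (n : nat) (g : nat -> R) :
  \sum_(S : {set 'I_n}) g #|S| = \sum_(k < n.+1) 'C(n, k)%:R * g k.
Proof.
have Sn (S : {set 'I_n}) : (#|S| < n.+1)%N by rewrite ltnS card_ord_set_le.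
rewrite (partition_big (fun S => Ordinal (Sn S)) xpredT)//=.
apply: eq_bigr => k _; rewrite -[n in 'C(n, _)](card_ord n) -card_draws.
rewrite mulr_natl -sumr_const; apply: eq_big => [S|S /eqP <-//].
by rewrite inE -val_eqE.
Qed.

(** * Random variables with finitely many values, and the law of the set of ones *)

Lemma measurable_fun_fintype (d d' : measure_display) (T : measurableType d)
    (U : measurableType d') (I : finType) (J : T -> I) (h : I -> U) :
  (forall i, measurable (J @^-1` [set i])) -> measurable_fun setT (h \o J).
Proof.
move=> mJ _ B _; rewrite setTI.
rewrite (_ : _ @^-1` _ = \bigcup_(i in h @^-1` B) (J @^-1` [set i])).
  exact: fin_bigcup_measurable.
by apply/seteqP; split=> [w Bw|w [i Bi /= Ji]]; [exists (J w)|rewrite /= Ji].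
Qed.

Lemma integral_fintype (d : measure_display) (T : measurableType d)
    (R : realType) (mu : measure T R) (I : finType) (J : T -> I) (h : I -> R) :
  (forall i, measurable (J @^-1` [set i])) -> (forall i, 0 <= h i) ->
  (\int[mu]_w (h (J w))%:E = \sum_i (h i)%:E * mu (J @^-1` [set i]))%E.
Proof.
move=> mJ h0.
(* The fibres of [J] partition the space, so exactly one indicator is 1 at each point. *)
transitivity (\int[mu]_w (\sum_i (h i)%:E * (\1_(J @^-1` [set i]) w)%:E))%E.
  apply: eq_integral => w _; rewrite (bigD1 (J w))//= indicE mem_set// mule1.
  rewrite big1 ?adde0// => i iJ; rewrite indicE memNset ?mule0// => /= Ji.
  by rewrite Ji eqxx in iJ.
have mi i : measurable_fun setT (EFin \o \1_(J @^-1` [set i]) : T -> \bar R).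
  by apply/measurable_EFinP; exact: measurable_indic.
rewrite ge0_integral_sum//; last 2 first.
- by move=> i; apply: measurable_funeM; exact: mi.
- by move=> i w _; rewrite mule_ge0 ?lee_fin.
apply: eq_bigr => i _; rewrite (ge0_integralZl _ measurableT (mi i)) ?lee_fin// => [|w _].
  by rewrite integral_indic// setIT.
by rewrite /= lee_fin.
Qed.

Lemma bernoulli_lawE (d : measure_display) (T : measurableType d)
    (R : realType) (P : probability T R) (p : R) (X : {RV P >-> R})
    (B : set R) : 0 < p < 1 -> has_bernoulli_law p X -> measurable B ->
  P (X @^-1` B) = (p * (1 \in B)%:R + (1 - p) * (0 \in B)%:R)%:E.
Proof.
move=> /andP[p0 p1] lawX mB; have := lawX B mB.
rewrite /distribution /pushforward => ->.
rewrite bernoulli_probE; last by rewrite !ltW.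
by rewrite !diracE -!EFinM -EFinD.
Qed.

Definition ones (T : Type) (R : realType) (n : nat) (X : 'I_n -> T -> R) (w : T) :
  {set 'I_n} := [set i | X i w == 1]%SET.

(** Using the complement of 1 rather than the singleton 0 makes this hold at every [w], including
    the null set where some [X i] is neither 0 nor 1. *)
Lemma ones_preimage (T : Type) (R : realType) (n : nat) (X : 'I_n -> T -> R)
    (S : {set 'I_n}) : ones X @^-1` [set S] =
  \bigcap_(i in [set` [set: 'I_n]%SET])
     (X i @^-1` (if i \in S then [set 1] else ~` [set 1])).
Proof.
apply/seteqP; split=> [w /= <- i _|w /= wS].
  by rewrite inE /=; case: eqP.
apply/setP => i; rewrite inE; have := wS i; rewrite /= inE => /(_ isT).
by case: (i \in S) => /= /eqP // /negbTE.
Qed.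

Lemma measurable_ones (d : measure_display) (T : measurableType d)
    (R : realType) (P : probability T R) (n : nat)
    (X : 'I_n -> {RV P >-> R}) (S : {set 'I_n}) :
  measurable (ones X @^-1` [set S]).
Proof.
rewrite ones_preimage; apply: fin_bigcap_measurable => // i _.
by apply: measurable_funPTI; case: ifP => _ //; apply: measurableC.
Qed.

Lemma probability_ones (d : measure_display) (T : measurableType d)
    (R : realType) (P : probability T R) (n : nat) (p : R)
    (X : 'I_n -> {RV P >-> R}) (S : {set 'I_n}) :
  0 < p < 1 -> mutually_independent X -> (forall i, has_bernoulli_law p (X i)) ->
  P (ones X @^-1` [set S]) = (p ^+ #|S| * (1 - p) ^+ (n - #|S|))%:E.
Proof.
move=> p01 indepX lawX.
have mB i : measurable (if i \in S then [set 1] else ~` [set 1] : set R).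
  by case: ifP => _ //; apply: measurableC.
rewrite ones_preimage indepX//.
rewrite (eq_bigr (fun i => (if i \in S then p else 1 - p)%:E)) => [|i _]; last first.
  rewrite (bernoulli_lawE p01)//; case: ifP => _.
    rewrite mem_set// memNset ?mulr1 ?mulr0 ?addr0//=.
    by move/eqP; rewrite eq_sym oner_eq0.
  rewrite memNset => [|/=]; last exact.
  rewrite mem_set ?mulr1 ?mulr0 ?add0r//=.
  by move/eqP; rewrite eq_sym oner_eq0.
rewrite prodEFin (eq_bigl xpredT) => [|i]; last by rewrite inE.
rewrite (bigID (mem S))/= (eq_bigr (fun=> p)) => [|i ->//].
rewrite [X in _ * X](eq_bigr (fun=> 1 - p)) => [|i /negPf ->//].
by rewrite !prodr_const card_notin.
Qed.

Lemma ae_bernoulli (d : measure_display) (T : measurableType d)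
    (R : realType) (P : probability T R) (n : nat) (p : R)
    (X : 'I_n -> {RV P >-> R}) :
  0 < p < 1 -> (forall i, has_bernoulli_law p (X i)) ->
  \forall w \ae P, forall i, X i w = 0 \/ X i w = 1.
Proof.
move=> p01 lawX; apply: filter_forall => i.
have m01 : measurable (~` [set 0; 1] : set R).
  by apply: measurableC; apply: measurableU.
exists (X i @^-1` ~` [set 0; 1]); split.
- exact: measurable_funPTI.
- rewrite (bernoulli_lawE p01)// !memNset ?mulr0 ?addr0// => /=.
  + by apply; left.
  + by apply; right.
- by move=> w /= w01 [] ?; apply: w01; [left|right].
Qed.

Lemma sum_binomial_spectral (R : realFieldType) (n : nat) (p u v : R) (g : nat -> R) :
  \sum_(k < n.+1) 'C(n, k)%:R * (p ^+ k * (1 - p) ^+ (n - k) *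
    ((k%:R - 1) * u + (n%:R - k%:R - 1) * v + g k)) =
  (n%:R * p - 1) * u + (n%:R * (1 - p) - 1) * v +
  \sum_(k < n.+1) 'C(n, k)%:R * p ^+ k * (1 - p) ^+ (n - k) * g k.
Proof.
pose b k : R := 'C(n, k)%:R * p ^+ k * (1 - p) ^+ (n - k).
(* The weight of [b k] is sorted into a constant, a multiple of k and [g k], to be summed by total
   mass 1, by the mean, and left as is. *)
transitivity (\sum_(k < n.+1) (b k * ((n%:R - 1) * v - u) + k%:R * b k * (u - v) + b k * g k)).
  by apply: eq_bigr => k _; rewrite /b; ring.
rewrite !big_split -!mulr_suml /= sum_binomial mean_binomial; ring.
Qed.

(** * Measurability of the random spectral distribution, and the averaging *)

Lemma measurable_threshold_rel (d : measure_display) (T : measurableType d)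
    (R : realType) (P : probability T R) (n : nat) (theta : R)
    (X : 'I_n -> {RV P >-> R}) (i j : 'I_n) :
  measurable_fun setT (fun w => threshold_rel theta (fun i => X i w) i j).
Proof.
rewrite /threshold_rel; case: (i != j) => /=; last exact: measurable_cst.
by apply: measurable_fun_ltr => //; apply: measurable_funD.
Qed.

Lemma measurable_spectral_distribution (d : measure_display) (T : measurableType d)
    (R : realType) (P : probability T R) (n : nat) (theta : R)
    (X : 'I_n -> {RV P >-> R}) (B : set R) :
  measurable_fun setT
    (fun w => spectral_distribution R (threshold_graph theta (fun i => X i w)) B).
Proof.
(* Off the null set the set of ones need not determine the graph, so the factorization goes through
   the edge set, which also takes finitely many values. *)
pose e w := [set ij | threshold_rel theta (fun i => X i w) ij.1 ij.2]%SET.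
pose h (E : {set 'I_n * 'I_n}) : \bar R :=
  (n%:R^-1 * \sum_(z <- spectrum (\matrix_(i, j) ((i, j) \in E)%:R)) (z \in B)%:R)%:E.
rewrite (_ : (fun _ => _) = h \o e); last first.
  apply/funext => w; rewrite spectral_distributionE /h /=; congr (_ * _)%:E.
  by congr (\sum_(_ <- spectrum _) _); apply/matrixP => i j; rewrite !mxE inE.
apply: measurable_fun_fintype => E.
rewrite (_ : _ @^-1` _ = \bigcap_(ij in [set: 'I_n * 'I_n])
    ((fun w => threshold_rel theta (fun i => X i w) ij.1 ij.2) @^-1` [set ij \in E])).
  apply: fin_bigcap_measurable => // ij _; rewrite -[X in measurable X]setTI.
  exact: measurable_threshold_rel.
apply/seteqP; split=> [w /= <- ij _|w wE]; first by rewrite /= inE.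
by apply/setP => ij; rewrite inE; exact: wE.
Qed.

Theorem theorem7 (d : measure_display) (T : measurableType d) (R : realType)
    (P : probability T R) (n : nat) (p theta : R) (X : 'I_n -> {RV P >-> R})
    (hn : (2 <= n)%N) (hp : 0 < p < 1) (htheta : 0 <= theta < 1)
    (hindep : mutually_independent X)
    (hlaw : forall i : 'I_n, has_bernoulli_law p (X i))
    (B : set R) (hB : measurable B) :
  mean_spectral_distribution P
    (fun w => threshold_graph theta (fun i => X i w)) B =
  ((p - n%:R^-1)%:E * \d_((-1)%R : R) B + (1 - p - n%:R^-1)%:E * \d_(0%R : R) B
   + (n%:R^-1)%:E * \sum_(0 <= k < n.+1)
       ('C(n, k)%:R * p ^+ k * (1 - p) ^+ (n - k))%:E
       * (\d_(lambda_minus R n k) B + \d_(lambda_plus R n k) B))%E.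
Proof.
pose F (z : R) : R := (z \in B)%:R.
pose c (S : {set 'I_n}) : R := n%:R^-1 * \sum_(z <- spectrum (split_mx R S)) F z.
have c0 S : 0 <= c S by rewrite mulr_ge0 ?invr_ge0// sumr_ge0.
(* The graph agrees with the split graph on the set of ones only almost surely; this suffices under
   the integral once both integrands are measurable. *)
have -> : mean_spectral_distribution P
    (fun w => threshold_graph theta (fun i => X i w)) B =
    (\int[P]_w (c (ones X w))%:E)%E.
  apply: ae_eq_integral => //.
  - exact: measurable_spectral_distribution.
  - exact: (measurable_fun_fintype (EFin \o c) (measurable_ones X)).
  - apply: filterS (ae_bernoulli hp hlaw) => w w01 _.
    by rewrite spectral_distributionE adjacency_threshold_graph.
rewrite integral_fintype//; last exact: measurable_ones.
rewrite (eq_bigr (fun S => (c S * (p ^+ #|S| * (1 - p) ^+ (n - #|S|)))%:E)) => [|S _]; last first.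
  by rewrite [RHS]EFinM; congr (_ * _)%E; exact: probability_ones.
rewrite sumEFin.
under eq_bigr do rewrite /c sum_spectrum_split_mx -mulrA [X in _ * X]mulrC.
(* Each summand depends on S only through its size, so the sum over subsets becomes a binomial
   sum. *)
rewrite -mulr_sumr (sum_card_set n (fun k => p ^+ k * (1 - p) ^+ (n - k) *
  ((k%:R - 1) * F (-1) + (n%:R - k%:R - 1) * F 0 +
   (F (lambda_minus R n k) + F (lambda_plus R n k))))).
rewrite (sum_binomial_spectral n p _ _
  (fun k => F (lambda_minus R n k) + F (lambda_plus R n k))) big_mkord.
under [in RHS]eq_bigr do rewrite !diracE -EFinD -EFinM.
rewrite sumEFin !diracE -!EFinM -!EFinD; congr EFin.
have n0 : n%:R != 0 :> R by rewrite pnatr_eq0 -lt0n (leq_trans _ hn).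
by rewrite -/(F 0) -/(F (-1)); field.
Qed.
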